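(* Let $v=\sqrt{s(8s^2-11s+8)}$. The functions $$T_{41}=\frac12+\frac{(s+1)(32s^8-320s^7+1112s^6-2420s^5+3167s^4-2420s^3+1112s^2-320s+32)}{54s(s-1)\,v^3},$$ $$y_{41}=\frac12-\frac{56s^7-166s^6+318s^5-269s^4+31s^3+75s^2-28s+8}{18s(s-1)(2s^3+4s^2-4s+3)\,v}$$ (with the same branch of $v$ in both) parametrize an algebraic solution $y_{41}(T_{41})$ of the sixth Painlev\'e equation $P_{VI}(1/3,1/3,1/3,1/3;T_{41})$.
   Context: $P_{VI}(\theta_0,\theta_1,\theta_T,\theta_\infty;T)$ denotes the sixth Painlev\'e equation $$\begin{aligned}\frac{d^2y}{dT^2}={}&\frac12\left(\frac1y+\frac1{y-1}+\frac1{y-T}\right)\left(\frac{dy}{dT}\right)^2-\left(\frac1T+\frac1{T-1}+\frac1{y-T}\right)\frac{dy}{dT}\\&+\frac{y(y-1)(y-T)}{T^2(T-1)^2}\left(\alpha+\beta\frac{T}{y^2}+\gamma\frac{T-1}{(y-1)^2}+\delta\frac{T(T-1)}{(y-T)^2}\right)\end{aligned}$$ for $y=y(T)$, with $\alpha=\frac{(\theta_\infty-1)^2}{2}$, $\beta=-\frac{\theta_0^2}{2}$, $\gamma=\frac{\theta_1^2}{2}$, $\delta=\frac{1-\theta_T^2}{2}$. That functions $T$ and $y$ on the algebraic curve with coordinates $(s,v)$ parametrize a solution means that $T$ is non-constant and that $y$, viewed locally as a function of $T$, satisfies the equation. *)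

(* Defs.v *)
From Stdlib Require Import Reals List.
From Coquelicot Require Import Coquelicot.

Open Scope C_scope.

(* The right-hand side of P_VI(th0, th1, thT, thoo; t), with dy standing for
   dy/dt. Division on C is total, so this is the right-hand side only where
   PVI_regular holds. *)
Definition PVI_rhs (th0 th1 thT thoo t y dy : C) : C :=
  let alpha := (thoo - 1) ^ 2 / 2 in
  let beta := - (th0 ^ 2) / 2 in
  let gamma := th1 ^ 2 / 2 in
  let delta := (1 - thT ^ 2) / 2 in
  1 / 2 * (1 / y + 1 / (y - 1) + 1 / (y - t)) * dy ^ 2
  - (1 / t + 1 / (t - 1) + 1 / (y - t)) * dy
  + y * (y - 1) * (y - t) / (t ^ 2 * (t - 1) ^ 2)
    * (alpha + beta * (t / y ^ 2) + gamma * ((t - 1) / (y - 1) ^ 2)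
       + delta * (t * (t - 1) / (y - t) ^ 2)).

Definition PVI_regular (t y : C) : Prop :=
  t <> 0 /\ t <> 1 /\ y <> 0 /\ y <> 1 /\ y <> t.

(* The derivatives are complex derivatives, so Y is holomorphic near t0. *)
Definition solves_PVI_near (th0 th1 thT thoo : C) (Y : C -> C) (t0 : C)
  : Prop :=
  exists Y1 Y2 : C -> C,
    locally t0 (fun t : C =>
      is_derive Y t (Y1 t) /\ is_derive Y1 t (Y2 t) /\
      PVI_regular t (Y t) /\
      Y2 t = PVI_rhs th0 th1 thT thoo t (Y t) (Y1 t)).

(* Evaluation at (t, y) of the polynomial with coefficients a i j,
   0 <= i, j <= n. *)
Definition eval2 (n : nat) (a : nat -> nat -> C) (t y : C) : C :=
  sum_n (fun i => sum_n (fun j => a i j * t ^ i * y ^ j) n) n.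

Definition nonzero2 (n : nat) (a : nat -> nat -> C) : Prop :=
  exists i j : nat, (i <= n)%nat /\ (j <= n)%nat /\ a i j <> 0.

(* Rational functions on a curve are represented by total functions, whose
   values at their finitely many poles are meaningless; properties of such
   functions are therefore required off a finite set of points. *)
Definition for_almost_all (curve P : C * C -> Prop) : Prop :=
  exists E : list (C * C), forall p, curve p -> ~ In p E -> P p.

Definition nonconstant_on (curve : C * C -> Prop) (f : C * C -> C) : Prop :=
  forall c : C, ~ for_almost_all curve (fun p => f p = c).

(* The curve is in C * C and T, y are rational functions on it. Near almost
   every point p of the curve, y is a function Y of T, where Y, near T p, is a
   holomorphic solution of P_VI. The solution is algebraic: one nonzero
   polynomial relation F (t, Y t) = 0 holds for all these Y. *)
Definition parametrize_algebraic_PVI_solution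
  (curve : C * C -> Prop) (T y : C * C -> C) (th0 th1 thT thoo : C) : Prop :=
  nonconstant_on curve T /\
  exists (n : nat) (a : nat -> nat -> C),
    nonzero2 n a /\
    for_almost_all curve (fun p : C * C =>
      exists Y : C -> C,
        locally p (fun q : C * C => curve q -> y q = Y (T q)) /\
        solves_PVI_near th0 th1 thT thoo Y (T p) /\
        locally (T p) (fun t : C => eval2 n a t (Y t) = 0)).

(* The curve v = sqrt (s (8 s^2 - 11 s + 8)), with both branches of v. *)
Definition curve41 (p : C * C) : Prop :=
  let (s, v) := p in v ^ 2 = s * (8 * s ^ 2 - 11 * s + 8).

Definition T41 (p : C * C) : C :=
  let (s, v) := p in
  1 / 2
  + (s + 1) * (32 * s ^ 8 - 320 * s ^ 7 + 1112 * s ^ 6 - 2420 * s ^ 5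
               + 3167 * s ^ 4 - 2420 * s ^ 3 + 1112 * s ^ 2 - 320 * s + 32)
    / (54 * s * (s - 1) * v ^ 3).

Definition y41 (p : C * C) : C :=
  let (s, v) := p in
  1 / 2
  - (56 * s ^ 7 - 166 * s ^ 6 + 318 * s ^ 5 - 269 * s ^ 4 + 31 * s ^ 3
     + 75 * s ^ 2 - 28 * s + 8)
    / (18 * s * (s - 1) * (2 * s ^ 3 + 4 * s ^ 2 - 4 * s + 3) * v).

(* Main.v *)
Require Import Defs.
From Stdlib Require Import Reals List Lra Lia Psatz ClassicalEpsilon FinFun.
From Coquelicot Require Import Coquelicot.
Import ListNotations.

Open Scope C_scope.

(** Put u = T - 1/2. On the curve, v only enters through its oddness: u and
    y - 1/2 are both v times a rational function of s. Hence u^2 = g(s) and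
    (y - 1/2) / u = r(s) are rational functions of s alone ([sqT], [ratio]), and
    the curve disappears from the problem: near almost every point, s is a local
    holomorphic function sigma of w = u^2, namely the inverse of g, and the
    solution is
      Y(t) = 1/2 + u r(sigma(u^2)),  u = t - 1/2.
    Its derivative dY/dt = r + 2 g r' / g' is again a rational function m(s)
    ([slope]).

    Since theta_0 = theta_1, the sixth Painleve equation is invariant under
    (t, y) -> (1 - t, 1 - y). Written in terms of u and r it is therefore u times
    an expression in u^2, r and m ([reduced_PVI_rhs]), and the equation becomes
    the system
      r' = (m - r) g' / (2 g),   m' = (g' / 2) reduced_PVI_rhs(g, r, m)
    of identities between rational functions of s ([is_derive_ratio],
    [is_derive_slope]). They are decidable computations, kept small by the
    factorisations of t (t - 1), y (y - 1) and (y - t) / u.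

    The analytic input is a holomorphic inverse function theorem
    ([holomorphic_local_inverse]), proved by a Newton iteration with fixed slope.

    That the solution is algebraic is a dimension count
    ([algebraic_dependence]): after multiplication by a common denominator, the
    (n + 1)^2 monomials T^i y^j with i, j <= n lie in a space of functions
    a(s) + v b(s) whose dimension grows only linearly in n, so that they are
    linearly dependent for large n.

    The excluded points are those whose s is a zero of one polynomial
    ([bad_poly]); they include the poles, the critical points of g and the points
    where t or y is singular for the equation. *)

(** * Complex derivatives *)

(** Derivatives at a point of C come with the uniform structure of the absolute
    ring C, neighbourhoods in C with the product structure; the modulus is the
    common language in which the estimates below are made. *)
Lemma is_derive_C_eps (f : C -> C) (x l : C) :
  is_derive f x l <->
  forall eps : R, (0 < eps)%R -> exists delta : R, (0 < delta)%R /\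
    forall y, (Cmod (y - x) < delta)%R ->
      (Cmod (f y - f x - l * (y - x)) <= eps * Cmod (y - x))%R.
Proof.
  split.
  - intros [_ H] eps Heps.
    destruct (H x (fun P HP => HP) (mkposreal eps Heps)) as [d Hd].
    exists d; split; [apply cond_pos|].
    intros y Hy. specialize (Hd y Hy).
    replace (f y - f x - l * (y - x)) with (f y - f x - (y - x) * l) by ring.
    exact Hd.
  - intros H. split.
    + apply is_linear_scal_l.
    + intros x' Hx' eps.
      assert (E : x = x') by (apply (is_filter_lim_locally_unique (V := AbsRing_NormedModule C_AbsRing) x x'); exact Hx').
      subst x'.
      destruct (H eps (cond_pos eps)) as [d [Hd0 Hd]].
      exists (mkposreal d Hd0). intros y Hy.
      specialize (Hd y Hy).
      replace (f y - f x - l * (y - x)) with (f y - f x - (y - x) * l) in Hd by ring.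
      exact Hd.
Qed.

Lemma locally_C_Cmod (x : C) (P : C -> Prop) :
  locally x P <->
  exists delta : R, (0 < delta)%R /\ forall y, (Cmod (y - x) < delta)%R -> P y.
Proof.
  split.
  - intros H. apply locally_C in H. destruct H as [d Hd]. exists d; split; [apply cond_pos|]. exact Hd.
  - intros [d [Hd0 Hd]]. apply locally_C. exists (mkposreal d Hd0). exact Hd.
Qed.

(** The product and chain rules want functions with values in the ring C as a
    module over itself, which is another normed module than the canonical one. *)
Lemma is_derive_C_absring (f : C -> C) (x l : C) :
  @is_derive C_AbsRing (AbsRing_NormedModule C_AbsRing) f x l <-> is_derive f x l.
Proof.
  split; intros [_ H]; (split; [apply is_linear_scal_l | exact H]).
Qed.

Lemma is_derive_C_mult (f g : C -> C) (x df dg : C) :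
  is_derive f x df -> is_derive g x dg ->
  is_derive (fun z => f z * g z) x (df * g x + f x * dg).
Proof.
  intros Hf Hg. apply is_derive_C_absring.
  apply (is_derive_mult (K := C_AbsRing) f g x df dg);
    [now apply is_derive_C_absring .. | exact Cmult_comm].
Qed.

Lemma is_derive_C_comp (f g : C -> C) (x df dg : C) :
  is_derive f (g x) df -> is_derive g x dg ->
  is_derive (fun z => f (g z)) x (dg * df).
Proof.
  intros Hf Hg.
  apply (is_derive_comp (K := C_AbsRing) f g x df dg Hf).
  now apply is_derive_C_absring.
Qed.

Lemma is_derive_C_plus (f g : C -> C) (x df dg : C) :
  is_derive f x df -> is_derive g x dg ->
  is_derive (fun z => f z + g z) x (df + dg).
Proof. exact (is_derive_plus f g x df dg). Qed.

Lemma is_derive_C_minus (f g : C -> C) (x df dg : C) :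
  is_derive f x df -> is_derive g x dg ->
  is_derive (fun z => f z - g z) x (df - dg).
Proof. exact (is_derive_minus f g x df dg). Qed.

Lemma is_derive_C_const (a x : C) : is_derive (fun _ => a) x (RtoC 0).
Proof. exact (is_derive_const a x). Qed.

Lemma is_derive_C_id (x : C) : is_derive (fun z : C => z) x (RtoC 1).
Proof. apply is_derive_C_absring. exact (is_derive_id x). Qed.

Lemma is_derive_C_pow (f : C -> C) (x df : C) (n : nat) :
  is_derive f x df ->
  is_derive (fun z => f z ^ n) x (INR n * f x ^ pred n * df).
Proof.
  intros Hf. induction n as [|n IH].
  - replace (INR 0 * f x ^ pred 0 * df) with (RtoC 0) by (simpl; ring).
    exact (is_derive_C_const 1 x).
  - replace (INR (S n) * f x ^ pred (S n) * df)
      with (df * f x ^ n + f x * (INR n * f x ^ pred n * df)).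
    + exact (is_derive_C_mult f (fun z => f z ^ n) x _ _ Hf IH).
    + rewrite S_INR, RtoC_plus. destruct n as [|n]; simpl; ring.
Qed.

Lemma is_derive_C_inv (x : C) : x <> 0 -> is_derive Cinv x (- / x ^ 2).
Proof.
  intros Hx. apply is_derive_C_eps. intros eps Heps.
  assert (Hm : (0 < Cmod x)%R) by now apply Cmod_gt_0.
  exists (Rmin (Cmod x / 2) (eps * Cmod x ^ 3 / 2)). split.
  { apply Rmin_pos; [lra|]. assert (0 < Cmod x ^ 3)%R by now apply pow_lt. nra. }
  intros y Hy.
  assert (Hy1 : (Cmod (y - x) < Cmod x / 2)%R)
    by (eapply Rlt_le_trans; [exact Hy | apply Rmin_l]).
  assert (Hy2 : (Cmod (y - x) < eps * Cmod x ^ 3 / 2)%R)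
    by (eapply Rlt_le_trans; [exact Hy | apply Rmin_r]).
  assert (Hxy : (Cmod x / 2 <= Cmod y)%R).
  { assert (Cmod x <= Cmod y + Cmod (y - x))%R; [|lra].
    replace x with (y + - (y - x)) at 1 by ring.
    eapply Rle_trans; [apply Cmod_triangle|]. rewrite Cmod_opp. lra. }
  assert (Hy0 : y <> 0) by (apply Cmod_gt_0; lra).
  replace (/ y - / x - - / x ^ 2 * (y - x))
    with ((y - x) * ((y - x) / (x ^ 2 * y))) by now field.
  rewrite Cmod_mult, Rmult_comm.
  apply Rmult_le_compat_r; [apply Cmod_ge_0|].
  rewrite Cmod_div, Cmod_mult, Cmod_pow
    by (apply Cmult_neq_0; [now apply Cpow_nz | easy]).
  assert (H2 : (0 < Cmod x ^ 2)%R) by now apply pow_lt.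
  apply Rmult_le_reg_r with (Cmod x ^ 2 * Cmod y)%R; [nra|].
  unfold Rdiv. rewrite Rmult_assoc, Rinv_l, Rmult_1_r by nra.
  apply Rle_trans with (eps * Cmod x ^ 3 / 2)%R; [lra|].
  replace (Cmod x ^ 3)%R with (Cmod x ^ 2 * Cmod x)%R by ring.
  apply Rle_trans with (eps * (Cmod x ^ 2 * (Cmod x / 2)))%R; [lra|].
  apply Rmult_le_compat_l; [lra|]. apply Rmult_le_compat_l; lra.
Qed.

Lemma is_derive_C_div (f g : C -> C) (x df dg : C) :
  is_derive f x df -> is_derive g x dg -> g x <> 0 ->
  is_derive (fun z => f z / g z) x ((df * g x - f x * dg) / g x ^ 2).
Proof.
  intros Hf Hg H0.
  replace ((df * g x - f x * dg) / g x ^ 2)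
    with (df * / g x + f x * (dg * - / g x ^ 2)) by now field.
  apply (is_derive_C_mult f (fun z => / g z)); [easy|].
  apply (is_derive_C_comp Cinv g); [now apply is_derive_C_inv | easy].
Qed.
(** Differentiates a rational expression, leaving the derivative as computed and
    the non-vanishing of the denominators as goals. *)
Ltac derive_C :=
  lazymatch goal with
  | |- is_derive (fun z => z) _ _ => apply is_derive_C_id
  | |- is_derive (fun z => @?f z + @?g z) _ _ => eapply (is_derive_C_plus f g); derive_C
  | |- is_derive (fun z => @?f z - @?g z) _ _ => eapply (is_derive_C_minus f g); derive_C
  | |- is_derive (fun z => @?f z * @?g z) _ _ => eapply (is_derive_C_mult f g); derive_C
  | |- is_derive (fun z => @?f z / @?g z) _ _ =>
      eapply (is_derive_C_div f g); [derive_C | derive_C |]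
  | |- is_derive (fun z => @?f z ^ ?n) _ _ => eapply (is_derive_C_pow f _ _ n); derive_C
  | |- is_derive (fun _ => ?a) ?x _ => exact (is_derive_C_const a x)
  end.

Lemma is_derive_C_eq (f : C -> C) (x l l' : C) :
  is_derive f x l -> l = l' -> is_derive f x l'.
Proof. intros H <-; exact H. Qed.

Lemma RtoC_pos_neq_0 (n : positive) : RtoC (IZR (Zpos n)) <> 0.
Proof. intros H. apply RtoC_inj in H. now apply eq_IZR in H. Qed.

Lemma Cdiv_neq_0 (x y : C) : x <> 0 -> y <> 0 -> x / y <> 0.
Proof.
  intros Hx Hy H. apply Hx. replace x with (x / y * y) by now field. rewrite H. ring.
Qed.

Lemma Copp_neq_0 (x : C) : x <> 0 -> - x <> 0.
Proof. intros Hx H. apply Hx. replace x with (- - x) by ring. rewrite H. ring. Qed.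

Ltac nonzero :=
  repeat first [assumption | apply Cdiv_neq_0 | apply Cmult_neq_0 | apply Copp_neq_0 | apply Cpow_nz
    | apply RtoC_pos_neq_0].
(** Turns the exponents produced by the power rule into integer literals, which
    is what the field tactic recognises as constants. *)
Ltac numerals :=
  rewrite ?INR_IZR_INZ;
  cbn [Z.of_nat Pos.of_succ_nat Pos.succ Init.Nat.pred].

(** * The holomorphic inverse function theorem *)

Lemma Cmod_minus_sym (x y : C) : Cmod (x - y) = Cmod (y - x).
Proof. rewrite <- Cmod_opp. f_equal. ring. Qed.

Lemma Cmod_triangle_minus (x y z : C) :
  (Cmod (x - z) <= Cmod (x - y) + Cmod (y - z))%R.
Proof. replace (x - z) with (x - y + (y - z)) by ring. apply Cmod_triangle. Qed.

Lemma Cmod_minus_eq0 (x y : C) : (Cmod (x - y) <= 0)%R -> x = y.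
Proof.
  intros H. assert (E : x - y = 0) by (apply Cmod_eq_0; generalize (Cmod_ge_0 (x - y)); lra).
  replace x with (x - y + y) by ring. rewrite E. ring.
Qed.

Lemma ball_segment (c x y : C) (r t : R) :
  (Cmod (x - c) < r)%R -> (Cmod (y - c) < r)%R -> (0 <= t <= 1)%R ->
  (Cmod (y + t * (x - y) - c) < r)%R.
Proof.
  intros Hx Hy Ht.
  replace (y + t * (x - y) - c) with (RtoC t * (x - c) + RtoC (1 - t) * (y - c))
    by (rewrite RtoC_minus; ring).
  eapply Rle_lt_trans; [apply Cmod_triangle|].
  rewrite !Cmod_mult, !Cmod_R, !Rabs_pos_eq by lra.
  destruct (Req_dec t 0) as [->|]; nra.
Qed.

(** The real mean value theorem for the component of f along f x - f y, on the
    segment from y to x: taking the scalar product with f x - f y itself gives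
    |f x - f y|^2 <= |f x - f y| M |x - y|. *)
Lemma mean_value_C (f f' : C -> C) (c : C) (r M : R) :
  (forall z, (Cmod (z - c) < r)%R ->
     is_derive f z (f' z) /\ (Cmod (f' z) <= M)%R) ->
  forall x y, (Cmod (x - c) < r)%R -> (Cmod (y - c) < r)%R ->
  (Cmod (f x - f y) <= M * Cmod (x - y))%R.
Proof.
  intros Hf x y Hx Hy.
  set (k := Cconj (f x - f y)).
  set (phi := fun t : R => Re (k * f (y + t * (x - y)))).
  set (dphi := fun t : R => Re (k * (f' (y + t * (x - y)) * (x - y)))).
  assert (Hd : forall t : R, (0 <= t <= 1)%R -> is_derive phi t (dphi t)).
  { intros t Ht. apply is_derive_Reals. intros eps Heps.
    destruct (Hf _ (ball_segment c x y r t Hx Hy Ht)) as [Hder _].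
    assert (HN : (0 < Cmod k * Cmod (x - y) + 1)%R).
    { generalize (Cmod_ge_0 k) (Cmod_ge_0 (x - y)). nra. }
    destruct (proj1 (is_derive_C_eps _ _ _) Hder
                (eps / (Cmod k * Cmod (x - y) + 1))%R) as [d [Hd0 Hd]].
    { now apply Rdiv_lt_0_compat. }
    assert (HN' : (0 < Cmod (x - y) + 1)%R) by (generalize (Cmod_ge_0 (x - y)); lra).
    exists (mkposreal (d / (Cmod (x - y) + 1)) (Rdiv_lt_0_compat _ _ Hd0 HN')).
    intros h Hh0 Hh. simpl in Hh.
    assert (Eh : Cmod (y + (t + h)%R * (x - y) - (y + t * (x - y)))
                 = (Rabs h * Cmod (x - y))%R).
    { replace (y + (t + h)%R * (x - y) - (y + t * (x - y))) with (h * (x - y))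
        by (rewrite RtoC_plus; ring).
      now rewrite Cmod_mult, Cmod_R. }
    assert (Hha : (0 < Rabs h)%R) by now apply Rabs_pos_lt.
    specialize (Hd (y + (t + h)%R * (x - y))). rewrite Eh in Hd.
    assert (Hlt : (Rabs h * Cmod (x - y) < d)%R).
    { apply Rle_lt_trans with (Rabs h * (Cmod (x - y) + 1))%R; [nra|].
      apply Rmult_lt_compat_r with (r := (Cmod (x - y) + 1)%R) in Hh; [|easy].
      unfold Rdiv in Hh. rewrite Rmult_assoc, Rinv_l, Rmult_1_r in Hh; lra. }
    specialize (Hd Hlt).
    set (z := y + t * (x - y)) in *. set (z' := y + (t + h)%R * (x - y)) in *.
    replace ((phi (t + h) - phi t) / h - dphi t)%R
      with (Re (k * (f z' - f z - f' z * (z' - z))) / h)%R.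
    2:{ replace (z' - z) with (RtoC h * (x - y))
          by (unfold z', z; rewrite RtoC_plus; ring).
        unfold phi, dphi. fold z z'.
        destruct k, (f z'), (f z), (f' z), (x - y). simpl. now field. }
    rewrite Rabs_div by easy.
    apply Rmult_lt_reg_r with (Rabs h); [easy|].
    unfold Rdiv. rewrite Rmult_assoc, Rinv_l, Rmult_1_r by lra.
    eapply Rle_lt_trans; [apply re_le_Cmod|]. rewrite Cmod_mult.
    apply Rle_lt_trans with
      (Cmod k * (eps / (Cmod k * Cmod (x - y) + 1) * (Rabs h * Cmod (x - y))))%R.
    { apply Rmult_le_compat_l; [apply Cmod_ge_0 | exact Hd]. }
    replace (Cmod k * (eps / (Cmod k * Cmod (x - y) + 1) * (Rabs h * Cmod (x - y))))%R
      with ((eps * Rabs h) * (1 - / (Cmod k * Cmod (x - y) + 1)))%R by (field; lra).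
    rewrite <- (Rmult_1_r (eps * Rabs h)) at 2.
    apply Rmult_lt_compat_l; [now apply Rmult_lt_0_compat|].
    assert (0 < / (Cmod k * Cmod (x - y) + 1))%R by now apply Rinv_0_lt_compat. lra. }
  destruct (MVT_gen phi 0 1 dphi) as [t [Ht E]].
  { intros t Ht. apply Hd. rewrite Rmin_left, Rmax_right in Ht by lra. lra. }
  { intros t Ht. apply continuity_pt_filterlim.
    apply (ex_derive_continuous phi). exists (dphi t). apply Hd.
    rewrite Rmin_left, Rmax_right in Ht by lra. lra. }
  rewrite Rmin_left, Rmax_right in Ht by lra.
  destruct (Hf _ (ball_segment c x y r t Hx Hy Ht)) as [_ HM].
  assert (E1 : (phi 1 - phi 0 = Cmod (f x - f y) ^ 2)%R).
  { unfold phi. replace (y + 1%R * (x - y)) with x by ring.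
    replace (y + 0%R * (x - y)) with y by ring.
    apply RtoC_inj. rewrite Cmod2_conj. fold k.
    unfold k. destruct (f x) as [a b], (f y) as [a' b'].
    apply injective_projections; simpl; ring. }
  assert (E2 : (dphi t <= Cmod (f x - f y) * (M * Cmod (x - y)))%R).
  { unfold dphi. eapply Rle_trans; [apply Rle_abs|].
    eapply Rle_trans; [apply re_le_Cmod|].
    rewrite !Cmod_mult. unfold k. rewrite Cmod_conj.
    apply Rmult_le_compat_l; [apply Cmod_ge_0|].
    apply Rmult_le_compat_r; [apply Cmod_ge_0 | exact HM]. }
  rewrite E1 in E.
  destruct (Req_dec (Cmod (f x - f y)) 0) as [E0|E0].
  - rewrite E0. apply Rmult_le_pos; [|apply Cmod_ge_0].
    eapply Rle_trans; [apply Cmod_ge_0 | exact HM].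
  - assert (0 < Cmod (f x - f y))%R by (generalize (Cmod_ge_0 (f x - f y)); lra).
    apply Rmult_le_reg_l with (Cmod (f x - f y)); [easy|]. lra.
Qed.

(** The mean value inequality for z |-> f z - f' s * z, whose derivative is small
    near s. *)
Lemma strictly_differentiable (f f' : C -> C) (s : C) :
  locally s (fun z => is_derive f z (f' z)) -> continuous f' s ->
  forall eps : R, (0 < eps)%R -> exists delta : R, (0 < delta)%R /\
    (forall z, (Cmod (z - s) < delta)%R ->
       is_derive f z (f' z) /\ (Cmod (f' z - f' s) <= eps)%R) /\
    forall x y, (Cmod (x - s) < delta)%R -> (Cmod (y - s) < delta)%R ->
      (Cmod (f x - f y - f' s * (x - y)) <= eps * Cmod (x - y))%R.
Proof.
  intros Hf Hc eps Heps.
  assert (Hc' : locally s (fun z => (Cmod (f' z - f' s) < eps)%R)).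
  { apply (Hc (fun w => (Cmod (w - f' s) < eps)%R)).
    apply locally_C_Cmod. now exists eps. }
  assert (H := filter_and _ _ Hf Hc').
  apply locally_C_Cmod in H. destruct H as [d [Hd0 Hd]].
  exists d. split; [easy|]. split.
  { intros z Hz. destruct (Hd z Hz). split; [easy|lra]. }
  intros x y Hx Hy.
  replace (f x - f y - f' s * (x - y))
    with ((f x - f' s * x) - (f y - f' s * y)) by ring.
  apply (mean_value_C (fun z => f z - f' s * z) (fun z => f' z - f' s) s d eps); try easy.
  intros z Hz. destruct (Hd z Hz) as [H1 H2]. split; [|lra].
  replace (f' z - f' s) with (f' z - (0 * z + f' s * 1)) by ring.
  apply (is_derive_C_minus f (fun z => f' s * z)); [easy|].
  apply (is_derive_C_mult (fun _ => f' s) (fun z => z));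
    [apply is_derive_C_const | apply is_derive_C_id].
Qed.

Lemma geometric_limit (x : nat -> C) (rho : R) :
  (forall n, (Cmod (x (S n) - x n) <= rho * (1 / 2) ^ n)%R) ->
  exists l, forall n, (Cmod (l - x n) <= 2 * rho * (1 / 2) ^ n)%R.
Proof.
  intros H.
  assert (Hs : ex_series (V := C_CompleteNormedModule) (fun n => x (S n) - x n)).
  { apply (ex_series_le (V := C_CompleteNormedModule) _ (fun n => rho * (1 / 2) ^ n)%R).
    - exact H.
    - apply (ex_series_scal (V := R_NormedModule) rho (fun n => (1/2) ^ n)%R).
      apply ex_series_geom. rewrite Rabs_pos_eq; lra. }
  destruct Hs as [l Hl]. exists (l + x O).
  assert (Hsum : forall n, sum_n (fun n => x (S n) - x n) n = x (S n) - x O).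
  { induction n as [|n IH]; [now rewrite sum_O|].
    rewrite sum_Sn, IH. change (x (S n) - x O + (x (S (S n)) - x (S n)) = x (S (S n)) - x O).
    ring. }
  assert (Htail : forall n m, (Cmod (x (n + m)%nat - x n)
                     <= 2 * rho * (1 / 2) ^ n - 2 * rho * (1 / 2) ^ (n + m))%R).
  { intros n. induction m as [|m IH].
    - rewrite Nat.add_0_r. replace (x n - x n) with (RtoC 0) by ring. rewrite Cmod_0. lra.
    - rewrite Nat.add_succ_r.
      eapply Rle_trans; [apply (Cmod_triangle_minus _ (x (n + m)%nat))|].
      specialize (H (n + m)%nat). simpl. lra. }
  assert (Hrho : (0 <= rho)%R).
  { specialize (H O). simpl in H. generalize (Cmod_ge_0 (x 1%nat - x O)). lra. }
  intros n. apply le_epsilon. intros eps Heps.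
  assert (Hev : eventually (fun m => (Cmod (sum_n (fun k => x (S k) - x k : C) m - l) < eps)%R)).
  { apply (Hl (fun w => (Cmod (w - l) < eps)%R)). apply locally_C_Cmod. now exists eps. }
  destruct Hev as [N HN]. specialize (HN (n + N)%nat ltac:(lia)).
  rewrite Hsum in HN.
  specialize (Htail n (S N)). rewrite Nat.add_succ_r in Htail.
  assert (0 <= (1/2) ^ S (n + N))%R by (apply pow_le; lra).
  eapply Rle_trans; [apply (Cmod_triangle_minus _ (x (S (n + N)%nat)))|].
  rewrite (Cmod_minus_sym (l + x O)).
  replace (x (S (n + N)) - (l + x O)) with (x (S (n + N)) - x O - l) by ring.
  nra.
Qed.

(** The iteration z |-> z + (w - f z) / d, with the slope d at s instead of the
    derivative at z, halves the defect w - f z at each step. *)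
Lemma local_surjection (f : C -> C) (s d : C) (delta : R) :
  (0 < delta)%R -> d <> 0 ->
  (forall x y, (Cmod (x - s) < delta)%R -> (Cmod (y - s) < delta)%R ->
     (Cmod (f x - f y - d * (x - y)) <= Cmod d / 2 * Cmod (x - y))%R) ->
  forall w, (Cmod (w - f s) < Cmod d * delta / 4)%R ->
  exists x, (Cmod (x - s) < delta)%R /\ f x = w.
Proof.
  intros Hdelta Hd Hf w Hw.
  assert (Hd0 : (0 < Cmod d)%R) by now apply Cmod_gt_0.
  set (x := fun n => Nat.iter n (fun z => z + (w - f z) / d) s).
  set (rho := (Cmod (w - f s) / Cmod d)%R).
  assert (Hrho0 : (0 <= rho)%R).
  { apply Rmult_le_pos; [apply Cmod_ge_0|]. left. now apply Rinv_0_lt_compat. }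
  assert (Hrho : (rho < delta / 4)%R).
  { unfold rho. apply Rmult_lt_reg_r with (Cmod d); [easy|].
    unfold Rdiv at 1. rewrite Rmult_assoc, Rinv_l, Rmult_1_r; lra. }
  assert (Hstep : forall n, x (S n) - x n = (w - f (x n)) / d).
  { intros n. unfold x. simpl. ring. }
  assert (Hinv : forall n, (Cmod (w - f (x n)) <= Cmod (w - f s) * (1 / 2) ^ n)%R /\
            (Cmod (x n - s) <= 2 * rho - 2 * rho * (1 / 2) ^ n)%R).
  { induction n as [|n [IH1 IH2]].
    - simpl. replace (s - s) with (RtoC 0) by ring. rewrite Cmod_0. lra.
    - assert (Hn : (Cmod (x (S n) - x n) <= rho * (1 / 2) ^ n)%R).
      { rewrite Hstep, Cmod_div by easy. unfold rho.
        replace (Cmod (w - f s) / Cmod d * (1 / 2) ^ n)%R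
          with (Cmod (w - f s) * (1 / 2) ^ n / Cmod d)%R by (field; lra).
        apply Rmult_le_compat_r; [left; now apply Rinv_0_lt_compat | easy]. }
      assert (H2 : (Cmod (x (S n) - s) <= 2 * rho - 2 * rho * (1 / 2) ^ S n)%R).
      { eapply Rle_trans; [apply (Cmod_triangle_minus _ (x n))|].
        change ((1 / 2) ^ S n)%R with (1 / 2 * (1 / 2) ^ n)%R. lra. }
      split; [|exact H2].
      assert (forall k, (0 <= rho * (1 / 2) ^ k)%R) as Hk
        by (intros k; apply Rmult_le_pos; [easy | apply pow_le; lra]).
      generalize (Hk n) (Hk (S n)). intros Hk1 Hk2.
      specialize (Hf (x (S n)) (x n) ltac:(lra) ltac:(lra)).
      rewrite (Hstep n) in Hf at 1.
      replace (f (x (S n)) - f (x n) - d * ((w - f (x n)) / d))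
        with (- (w - f (x (S n)))) in Hf by now field.
      rewrite Cmod_opp, Hstep, Cmod_div in Hf by easy.
      replace (Cmod d / 2 * (Cmod (w - f (x n)) / Cmod d))%R
        with (Cmod (w - f (x n)) / 2)%R in Hf by (field; lra).
      change ((1 / 2) ^ S n)%R with (1 / 2 * (1 / 2) ^ n)%R. lra. }
  destruct (geometric_limit x rho) as [l Hl].
  { intros n. rewrite Hstep, Cmod_div by easy. unfold rho.
    replace (Cmod (w - f s) / Cmod d * (1 / 2) ^ n)%R
      with (Cmod (w - f s) * (1 / 2) ^ n / Cmod d)%R by (field; lra).
    apply Rmult_le_compat_r; [left; now apply Rinv_0_lt_compat | apply Hinv]. }
  assert (Hls : (Cmod (l - s) < delta)%R).
  { specialize (Hl O). simpl in Hl. lra. }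
  exists l. split; [easy|].
  apply Cmod_minus_eq0, le_epsilon. intros eps Heps.
  (* B * (1/2)^n bounds |w - f l|: f has Lipschitz constant 3/2 |d| on the disc,
     and |l - x n| <= 2 rho / 2^n. *)
  set (B := (3 * Cmod d * rho + Cmod (w - f s))%R).
  assert (HB : (0 <= B)%R).
  { unfold B. generalize (Cmod_ge_0 (w - f s)). nra. }
  destruct (pow_lt_1_zero (1 / 2) ltac:(rewrite Rabs_pos_eq; lra) (eps / (B + 1)))
    as [n Hn]. { apply Rdiv_lt_0_compat; lra. }
  specialize (Hn n ltac:(lia)). rewrite Rabs_pos_eq in Hn by (apply pow_le; lra).
  assert (Hp : (0 < (1/2) ^ n)%R) by (apply pow_lt; lra).
  specialize (Hl n). destruct (Hinv n) as [H1 H2].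
  assert (Hk : (0 <= rho * (1 / 2) ^ n)%R) by (apply Rmult_le_pos; lra).
  specialize (Hf l (x n) Hls ltac:(lra)).
  assert (Hbig : (Cmod (f l - f (x n)) <= 3 / 2 * Cmod d * Cmod (l - x n))%R).
  { replace (f l - f (x n)) with (f l - f (x n) - d * (l - x n) + d * (l - x n)) by ring.
    eapply Rle_trans; [apply Cmod_triangle|]. rewrite Cmod_mult. lra. }
  eapply Rle_trans; [apply (Cmod_triangle_minus _ (f (x n)))|].
  rewrite (Cmod_minus_sym (f (x n))).
  apply Rle_trans with (B * (1 / 2) ^ n)%R.
  { unfold B. assert (3 / 2 * Cmod d * Cmod (l - x n) <= 3 * Cmod d * rho * (1 / 2) ^ n)%R by nra.
    lra. }
  apply Rmult_lt_compat_r with (r := (B + 1)%R) in Hn; [|lra].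
  unfold Rdiv in Hn. rewrite (Rmult_assoc eps), Rinv_l in Hn by lra. nra.
Qed.

(** On a small disc f expands distances by at least |f' s| / 2, so that it is
    injective there; the inverse is then Lipschitz, and dividing the expansion of
    f at sigma w by f' (sigma w) gives the expansion of sigma at w. *)
Lemma holomorphic_local_inverse (f f' : C -> C) (s : C) :
  locally s (fun z => is_derive f z (f' z)) -> continuous f' s -> f' s <> 0 ->
  exists sigma : C -> C,
    locally s (fun z => sigma (f z) = z) /\
    locally (f s) (fun w => f (sigma w) = w /\
      is_derive sigma w (/ f' (sigma w))).
Proof.
  intros Hf Hc Hd.
  assert (Hd0 : (0 < Cmod (f' s))%R) by now apply Cmod_gt_0.
  destruct (strictly_differentiable f f' s Hf Hc (Cmod (f' s) / 2) ltac:(lra))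
    as [delta [Hdelta [Hder Hstrict]]].
  set (d := f' s) in *.
  set (inv := fun w x => (Cmod (x - s) < delta)%R /\ f x = w).
  set (sigma := fun w => epsilon (inhabits (RtoC 0)) (inv w)).
  assert (Hsigma : forall w, (Cmod (w - f s) < Cmod d * delta / 4)%R -> inv w (sigma w)).
  { intros w Hw. apply epsilon_spec.
    now apply (local_surjection f s d delta). }
  assert (Hexp : forall x y, (Cmod (x - s) < delta)%R -> (Cmod (y - s) < delta)%R ->
            (Cmod d / 2 * Cmod (x - y) <= Cmod (f x - f y))%R).
  { intros x y Hx Hy. specialize (Hstrict x y Hx Hy).
    assert (H : (Cmod (d * (x - y)) <= Cmod (f x - f y) + Cmod (f x - f y - d * (x - y)))%R).
    { replace (d * (x - y)) with (f x - f y + - (f x - f y - d * (x - y))) at 1 by ring.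
      eapply Rle_trans; [apply Cmod_triangle|]. rewrite Cmod_opp. lra. }
    rewrite Cmod_mult in H. lra. }
  exists sigma. split.
  - apply locally_C_Cmod. exists (delta / 6)%R. split; [lra|].
    intros z Hz.
    assert (Hs0 : (Cmod (s - s) < delta)%R).
    { replace (s - s) with (RtoC 0) by ring. now rewrite Cmod_0. }
    assert (Hz1 : (Cmod (z - s) < delta)%R) by lra.
    assert (Hw : (Cmod (f z - f s) < Cmod d * delta / 4)%R).
    { specialize (Hstrict z s Hz1 Hs0).
      replace (f z - f s) with (f z - f s - d * (z - s) + d * (z - s)) by ring.
      eapply Rle_lt_trans; [apply Cmod_triangle|]. rewrite Cmod_mult.
      apply Rmult_lt_compat_l with (r := Cmod d) in Hz; [lra | easy]. }
    destruct (Hsigma _ Hw) as [H1 H2].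
    specialize (Hexp _ _ H1 Hz1). rewrite H2 in Hexp.
    replace (f z - f z) with (RtoC 0) in Hexp by ring. rewrite Cmod_0 in Hexp.
    apply Cmod_minus_eq0. nra.
  - apply locally_C_Cmod. exists (Cmod d * delta / 4)%R. split; [nra|].
    intros w Hw. destruct (Hsigma _ Hw) as [Hx Ex].
    split; [easy|].
    destruct (Hder _ Hx) as [Hderx Hclose].
    set (x := sigma w) in *.
    assert (Hfx : (Cmod d / 2 <= Cmod (f' x))%R).
    { assert (Cmod d <= Cmod (f' x) + Cmod (f' x - d))%R; [|lra].
      replace d with (f' x + - (f' x - d)) at 1 by ring.
      eapply Rle_trans; [apply Cmod_triangle|]. rewrite Cmod_opp. lra. }
    assert (Hfx0 : f' x <> 0) by (apply Cmod_gt_0; lra).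
    apply is_derive_C_eps. intros eps Heps.
    destruct (proj1 (is_derive_C_eps _ _ _) Hderx
                (eps * (Cmod (f' x) * (Cmod d / 2)))%R) as [e [He0 He]].
    { apply Rmult_lt_0_compat; [easy|]. nra. }
    exists (Rmin (e * (Cmod d / 2)) (Cmod d * delta / 4 - Cmod (w - f s))). split.
    { apply Rmin_pos; [nra|lra]. }
    intros w' Hw'.
    assert (Hw1 : (Cmod (w' - w) < e * (Cmod d / 2))%R)
      by (eapply Rlt_le_trans; [exact Hw' | apply Rmin_l]).
    assert (Hw2 : (Cmod (w' - w) < Cmod d * delta / 4 - Cmod (w - f s))%R)
      by (eapply Rlt_le_trans; [exact Hw' | apply Rmin_r]).
    destruct (Hsigma w') as [Hx' Ex'].
    { eapply Rle_lt_trans; [apply (Cmod_triangle_minus _ w)|]. lra. }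
    set (x' := sigma w') in *.
    specialize (Hexp x' x Hx' Hx). rewrite Ex, Ex' in Hexp.
    specialize (He x' ltac:(nra)). rewrite Ex, Ex' in He.
    change (sigma w) with x. fold x'.
    replace (x' - x - / f' x * (w' - w))
      with (- (w' - w - f' x * (x' - x)) / f' x) by now field.
    rewrite Cmod_div, Cmod_opp by easy.
    apply Rmult_le_reg_r with (Cmod (f' x)); [lra|].
    unfold Rdiv. rewrite Rmult_assoc, Rinv_l, Rmult_1_r by lra.
    eapply Rle_trans; [exact He|].
    replace (eps * (Cmod (f' x) * (Cmod d / 2)) * Cmod (x' - x))%R
      with ((eps * Cmod (f' x)) * (Cmod d / 2 * Cmod (x' - x)))%R by ring.
    replace (eps * Cmod (w' - w) * Cmod (f' x))%R
      with ((eps * Cmod (f' x)) * Cmod (w' - w))%R by ring.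
    apply Rmult_le_compat_l; [nra | easy].
Qed.

(** * Finiteness of zero sets of polynomials *)

(** Coefficients in increasing degree. *)
Definition peval (l : list C) (s : C) : C :=
  fold_right (fun c acc => c + s * acc) 0 l.

Definition finite_zeros (f : C -> C) : Prop :=
  exists L : list C, forall s, f s = 0 -> In s L.

(** Ruffini's division by X - a, arranged so that the leading coefficient c is
    visibly preserved. *)
Lemma peval_divide (c a : C) (l : list C) (x : C) :
  exists l', length l' = length l /\ forall s,
    peval (x :: l ++ [c]) s - peval (x :: l ++ [c]) a = (s - a) * peval (l' ++ [c]) s.
Proof.
  revert x. induction l as [|y l IH]; intros x.
  - exists []. split; [easy|]. intros s. simpl. ring.
  - destruct (IH y) as [l' [Hl' E]].
    exists (peval (y :: l ++ [c]) a :: l'). split; [simpl; lia|].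
    intros s. specialize (E s).
    change (x + s * peval (y :: l ++ [c]) s - (x + a * peval (y :: l ++ [c]) a)
            = (s - a) * (peval (y :: l ++ [c]) a + s * peval (l' ++ [c]) s)).
    replace ((s - a) * (peval (y :: l ++ [c]) a + s * peval (l' ++ [c]) s))
      with ((s - a) * peval (y :: l ++ [c]) a + s * ((s - a) * peval (l' ++ [c]) s)) by ring.
    rewrite <- E. ring.
Qed.

Lemma peval_finite_zeros (l : list C) (c : C) :
  c <> 0 -> finite_zeros (peval (l ++ [c])).
Proof.
  intros Hc. remember (length l) as n eqn:Hn. revert l Hn.
  induction n as [|n IH]; intros l Hn.
  - destruct l; [|easy]. exists []. intros s Hs. apply Hc.
    rewrite <- Hs. simpl. ring.
  - destruct l as [|x l]; [easy|].
    destruct (excluded_middle_informative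
                (exists a, peval ((x :: l) ++ [c]) a = 0)) as [[a Ha]|H].
    + destruct (peval_divide c a l x) as [l' [Hl' E]].
      destruct (IH l') as [L HL]; [simpl in Hn; lia|].
      exists (a :: L). intros s Hs. simpl.
      specialize (E s). simpl app in Ha, Hs. rewrite Hs, Ha in E.
      destruct (Ceq_dec a s) as [Eas|Eas]; [now left | right].
      apply HL. destruct (Ceq_dec (peval (l' ++ [c]) s) 0) as [?|Hne]; [easy|].
      exfalso. apply (Cmult_neq_0 (s - a) (peval (l' ++ [c]) s)); try easy.
      * intros E0. apply Eas. replace s with (s - a + a) by ring. rewrite E0. ring.
      * rewrite <- E. ring.
    + exists []. intros s Hs. apply H. now exists s.
Qed.

Lemma finite_zeros_ext (f g : C -> C) :
  (forall s, f s = g s) -> finite_zeros f -> finite_zeros g.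
Proof.
  intros E [L HL]. exists L. intros s Hs. apply HL. now rewrite E.
Qed.

Lemma finite_zeros_mult (f g : C -> C) :
  finite_zeros f -> finite_zeros g -> finite_zeros (fun s => f s * g s).
Proof.
  intros [L HL] [M HM]. exists (L ++ M). intros s Hs. apply in_or_app.
  destruct (Ceq_dec (f s) 0) as [E|E]; [left; now apply HL|].
  destruct (Ceq_dec (g s) 0) as [E'|E']; [right; now apply HM|].
  now destruct (Cmult_neq_0 _ _ E E').
Qed.

(** * Algebraic dependence of functions on the curve *)

Definition lsum {X : Type} (l : list X) (f : X -> C) : C :=
  fold_right (fun x acc => f x + acc) 0 l.

Lemma lsum_app {X} (l m : list X) (f : X -> C) : lsum (l ++ m) f = lsum l f + lsum m f.
Proof. induction l as [|x l IH]; simpl; [ring|]. rewrite IH. ring. Qed.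

Lemma lsum_ext {X} (l : list X) (f g : X -> C) :
  (forall x, In x l -> f x = g x) -> lsum l f = lsum l g.
Proof.
  induction l as [|x l IH]; intros H; simpl; [easy|].
  rewrite H, IH; [easy | intros; apply H; now right | now left].
Qed.

Lemma lsum_0 {X} (l : list X) (f : X -> C) :
  (forall x, In x l -> f x = 0) -> lsum l f = 0.
Proof.
  induction l as [|x l IH]; intros H; simpl; [easy|].
  rewrite H, IH; [ring | intros; apply H; now right | now left].
Qed.

Lemma lsum_lin {X} (l : list X) (f g : X -> C) (a b : C) :
  lsum l (fun x => a * f x + b * g x) = a * lsum l f + b * lsum l g.
Proof. induction l as [|x l IH]; simpl; [ring|]. rewrite IH. ring. Qed.

(** Gaussian elimination on the last coordinate: a pivot x0 is removed from the
    family, and its coefficient is recovered at the end. *)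
Lemma linear_dependence {X : Type} (N : nat) :
  forall (l : list X) (f : X -> nat -> C), NoDup l -> (N < length l)%nat ->
  exists c : X -> C, (exists x, In x l /\ c x <> 0) /\
    forall k, (k < N)%nat -> lsum l (fun x => c x * f x k) = 0.
Proof.
  induction N as [|N IH]; intros l f Hnd HN.
  - destruct l as [|x l]; [simpl in HN; lia|].
    exists (fun _ => RtoC 1). split; [exists x; split; [now left | apply C1_nz]|].
    intros k Hk. lia.
  - destruct (excluded_middle_informative
                (exists x0, In x0 l /\ f x0 N <> 0)) as [[x0 [Hx0 Hf0]]|Hno].
    + destruct (in_split _ _ Hx0) as [l1 [l2 ->]].
      destruct (NoDup_remove _ _ _ Hnd) as [Hnd' Hx0'].
      rewrite length_app in HN. simpl in HN.
      destruct (IH (l1 ++ l2) (fun x k => f x k - f x N / f x0 N * f x0 k)) as [c [[x [Hx Hcx]] Hc]].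
      { easy. } { rewrite length_app. lia. }
      set (c0 := - lsum (l1 ++ l2) (fun x => c x * f x N) / f x0 N).
      set (c' := fun x => if excluded_middle_informative (x = x0) then c0 else c x).
      assert (Hc' : forall x, In x (l1 ++ l2) -> c' x = c x).
      { intros y Hy. unfold c'. destruct excluded_middle_informative; congruence. }
      assert (Hsum : forall k, lsum (l1 ++ x0 :: l2) (fun x => c' x * f x k)
                = c0 * f x0 k + lsum (l1 ++ l2) (fun x => c x * f x k)).
      { intros k. rewrite <- (lsum_ext (l1 ++ l2) (fun x => c' x * f x k))
          by (intros y Hy; now rewrite Hc').
        rewrite !lsum_app. simpl. unfold c' at 2.
        destruct excluded_middle_informative; [ring | easy]. }
      exists c'. split.
      * exists x. rewrite Hc' by easy. split; [|easy].
        apply in_app_or in Hx. apply in_or_app. simpl. tauto.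
      * intros k Hk. rewrite Hsum.
        destruct (Nat.eq_dec k N) as [->|Hkn].
        { unfold c0. now field. }
        specialize (Hc k ltac:(lia)).
        rewrite (lsum_ext _ _ (fun x => 1 * (c x * f x k)
                   + - (f x0 k / f x0 N) * (c x * f x N))) in Hc
          by (intros y _; now field).
        rewrite lsum_lin in Hc. rewrite <- Hc. unfold c0. now field.
    + destruct (IH l f Hnd ltac:(lia)) as [c [Hne Hc]].
      exists c. split; [easy|]. intros k Hk.
      destruct (Nat.eq_dec k N) as [->|Hkn]; [|apply Hc; lia].
      apply lsum_0. intros x Hx.
      destruct (Ceq_dec (f x N) 0) as [->|Hne']; [ring|].
      exfalso. apply Hno. now exists x.
Qed.

Fixpoint padd (p q : list C) : list C :=
  match p, q with
  | [], _ => q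
  | _, [] => p
  | a :: p', b :: q' => (a + b) :: padd p' q'
  end.

Fixpoint pmul (p q : list C) : list C :=
  match p with
  | [] => []
  | a :: p' => padd (map (Cmult a) q) (RtoC 0 :: pmul p' q)
  end.

Lemma peval_padd (p q : list C) (s : C) : peval (padd p q) s = peval p s + peval q s.
Proof.
  revert q. induction p as [|a p IH]; intros [|b q]; simpl; try ring.
  rewrite IH. ring.
Qed.

Lemma peval_pmul (p q : list C) (s : C) : peval (pmul p q) s = peval p s * peval q s.
Proof.
  induction p as [|a p IH]; [simpl; ring|].
  change (pmul (a :: p) q) with (padd (map (Cmult a) q) (RtoC 0 :: pmul p q)).
  rewrite peval_padd.
  assert (E : peval (map (Cmult a) q) s = a * peval q s).
  { clear. induction q as [|b q IH]; simpl; [ring|]. rewrite IH. ring. }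
  rewrite E. simpl. rewrite IH. ring.
Qed.

Lemma length_padd (p q : list C) : length (padd p q) = Nat.max (length p) (length q).
Proof.
  revert q. induction p as [|a p IH]; intros [|b q]; simpl; try easy.
  now rewrite IH.
Qed.

Lemma length_pmul (p q : list C) : (length (pmul p q) <= length p + length q)%nat.
Proof.
  induction p as [|a p IH]; [simpl; lia|].
  change (pmul (a :: p) q) with (padd (map (Cmult a) q) (RtoC 0 :: pmul p q)).
  rewrite length_padd, length_map. simpl. lia.
Qed.

(** v^2 is a polynomial in s on the curve, so that polynomials in (s, v) reduce
    to the form a(s) + v b(s); k bounds the number of coefficients of a and of b. *)
Definition curve_poly_le (k : nat) (f : C * C -> C) : Prop :=
  exists a b : list C, (length a <= k)%nat /\ (length b <= k)%nat /\
    forall s v, curve41 (s, v) -> f (s, v) = peval a s + v * peval b s.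
Lemma curve_poly_le_mono (j k : nat) (f : C * C -> C) : (j <= k)%nat -> curve_poly_le j f -> curve_poly_le k f.
Proof.
  intros H [a [b [Ha [Hb E]]]]. exists a, b. repeat split; [lia | lia | easy].
Qed.

Lemma curve_poly_le_const (c : C) : curve_poly_le 1 (fun _ => c).
Proof. exists [c], []. repeat split; simpl; auto. intros; ring. Qed.

Lemma curve_poly_le_fst : curve_poly_le 2 fst.
Proof. exists [RtoC 0; RtoC 1], []. repeat split; simpl; auto. intros; ring. Qed.

Lemma curve_poly_le_snd : curve_poly_le 1 snd.
Proof. exists [], [RtoC 1]. repeat split; simpl; auto. intros; ring. Qed.

Lemma curve_poly_le_plus (j k : nat) (f g : C * C -> C) :
  curve_poly_le j f -> curve_poly_le k g -> curve_poly_le (j + k) (fun p => f p + g p).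
Proof.
  intros [a [b [Ha [Hb E]]]] [a' [b' [Ha' [Hb' E']]]].
  exists (padd a a'), (padd b b'). rewrite !length_padd. repeat split; [lia | lia |].
  intros s v H. rewrite E, E', !peval_padd by easy. ring.
Qed.

(** The 4 is the number of coefficients of the cubic that replaces v^2. *)
Lemma curve_poly_le_mult (j k : nat) (f g : C * C -> C) :
  curve_poly_le j f -> curve_poly_le k g -> curve_poly_le (j + k + 4) (fun p => f p * g p).
Proof.
  intros [a [b [Ha [Hb E]]]] [a' [b' [Ha' [Hb' E']]]].
  set (P := [RtoC 0; RtoC 8; RtoC (-11); RtoC 8]).
  exists (padd (pmul a a') (pmul P (pmul b b'))), (padd (pmul a b') (pmul b a')).
  rewrite !length_padd.
  generalize (length_pmul a a') (length_pmul b b') (length_pmul a b') (length_pmul b a')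
    (length_pmul P (pmul b b')).
  intros. simpl length in *. repeat split; [lia | lia |].
  intros s v Hv. rewrite E, E', !peval_padd, !peval_pmul by easy.
  assert (EP : peval P s = v ^ 2) by (rewrite Hv; simpl; ring).
  rewrite EP. ring.
Qed.

Lemma curve_poly_le_pow (d : nat) (f : C * C -> C) (i : nat) :
  curve_poly_le d f -> curve_poly_le ((d + 4) * i + 1) (fun p => f p ^ i).
Proof.
  intros Hf. induction i as [|i IH].
  - apply (curve_poly_le_mono 1); [lia | exact (curve_poly_le_const 1)].
  - apply (curve_poly_le_mono (d + ((d + 4) * i + 1) + 4)); [lia|].
    exact (curve_poly_le_mult _ _ f (fun p => f p ^ i) Hf IH).
Qed.

Lemma lsum_peval {X} (l : list X) (c : X -> C) (N : nat) (s : C) :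
  forall a : X -> list C,
  (forall x, In x l -> (length (a x) <= N)%nat) ->
  (forall k, (k < N)%nat -> lsum l (fun x => c x * nth k (a x) 0) = 0) ->
  lsum l (fun x => c x * peval (a x) s) = 0.
Proof.
  induction N as [|N IH]; intros a Hlen Ha.
  - apply lsum_0. intros x Hx. specialize (Hlen x Hx).
    destruct (a x); [simpl; ring | simpl in Hlen; lia].
  - rewrite (lsum_ext _ _ (fun x => 1 * (c x * nth 0 (a x) 0)
                              + s * (c x * peval (tl (a x)) s))).
    + rewrite lsum_lin, Ha, (IH (fun x => tl (a x))); [ring | | | lia].
      * intros x Hx. specialize (Hlen x Hx). destruct (a x); simpl in *; lia.
      * intros k Hk. refine (eq_trans _ (Ha (S k) _)); [|lia]. apply lsum_ext.
        intros x _. destruct (a x); [destruct k|]; reflexivity.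
    + intros x _. destruct (a x); simpl; ring.
Qed.

Lemma lsum_grid (n : nat) (g : nat -> nat -> C) :
  lsum (list_prod (seq 0 (S n)) (seq 0 (S n))) (fun x => g (fst x) (snd x))
  = sum_n (fun i => sum_n (fun j => g i j) n) n.
Proof.
  assert (Hseq : forall m (h : nat -> C), lsum (seq 0 (S m)) h = sum_n h m).
  { intros m h. induction m as [|m IH].
    - rewrite sum_O. simpl. ring.
    - rewrite seq_S, lsum_app, IH, sum_Sn. simpl.
      change (sum_n h m + (h (S m) + 0) = sum_n h m + h (S m)). ring. }
  rewrite <- Hseq.
  assert (H : forall l m : list nat, lsum (list_prod l m) (fun x => g (fst x) (snd x))
            = lsum l (fun i => lsum m (fun j => g i j))).
  { intros l m. induction l as [|i l IH]; [easy|].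
    simpl. rewrite lsum_app, IH. f_equal.
    clear. induction m as [|j m IH]; simpl; [easy|]. now rewrite IH. }
  rewrite H. apply lsum_ext. intros i _. apply Hseq.
Qed.

Lemma NoDup_grid {X} (l m : list X) : NoDup l -> NoDup m -> NoDup (list_prod l m).
Proof.
  intros Hl Hm. induction Hl as [|x l Hx Hl IH]; simpl; [constructor|].
  apply NoDup_app; [ | exact IH | ].
  - apply FinFun.Injective_map_NoDup; [|easy]. intros y z E. now injection E.
  - intros [y z] H1 H2. apply in_map_iff in H1. destruct H1 as [w [E _]].
    injection E as <- <-. apply in_prod_iff in H2. tauto.
Qed.

(** The D^(2 n) (X / D)^i (Y / D)^j with i, j <= n have at most 2 N = 2 (2 (d + 4) n + 11)
    coefficients, and n = 4 (d + 4) makes this n^2 + 22, less than the number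
    (n + 1)^2 of monomials. *)
Lemma algebraic_dependence (d : nat) (X Y D : C * C -> C) :
  curve_poly_le d X -> curve_poly_le d Y -> curve_poly_le d D ->
  exists n a, nonzero2 n a /\ forall p, curve41 p -> D p <> 0 ->
    eval2 n a (X p / D p) (Y p / D p) = 0.
Proof.
  intros HX HY HD.
  set (n := (4 * (d + 4))%nat).
  set (N := ((d + 4) * (2 * n) + 11)%nat).
  set (l := list_prod (seq 0 (S n)) (seq 0 (S n))).
  set (mono := fun (x : nat * nat) p => X p ^ fst x * Y p ^ snd x * D p ^ (2 * n - fst x - snd x)).
  assert (Hl : forall x, In x l <-> (fst x <= n /\ snd x <= n)%nat).
  { intros [i j]. unfold l. rewrite in_prod_iff, !in_seq. simpl. lia. }
  set (coord := fun x (ab : list C * list C) =>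
    (length (fst ab) <= N)%nat /\ (length (snd ab) <= N)%nat /\
    forall s v, curve41 (s, v) -> mono x (s, v) = peval (fst ab) s + v * peval (snd ab) s).
  set (ab := fun x => epsilon (inhabits ([], [])) (coord x)).
  assert (Hab : forall x, In x l -> coord x (ab x)).
  { intros x Hx. apply epsilon_spec. apply Hl in Hx.
    assert (HN : ((d + 4) * fst x + 1 + ((d + 4) * snd x + 1) + 4
                  + ((d + 4) * (2 * n - fst x - snd x) + 1) + 4 <= N)%nat).
    { unfold N. replace (2 * n)%nat with (fst x + snd x + (2 * n - fst x - snd x))%nat at 2 by lia.
      clearbody n. generalize (2 * n - fst x - snd x)%nat. intros k. nia. }
    destruct (curve_poly_le_mono _ N _ HN
      (curve_poly_le_mult _ _ _ _ (curve_poly_le_mult _ _ _ _ (curve_poly_le_pow d X (fst x) HX) (curve_poly_le_pow d Y (snd x) HY))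
         (curve_poly_le_pow d D (2 * n - fst x - snd x) HD))) as [a [b H]].
    now exists (a, b). }
  destruct (linear_dependence (2 * N) l
     (fun x k => if (k <? N)%nat then nth k (fst (ab x)) 0 else nth (k - N) (snd (ab x)) 0))
    as [c [[x [Hx Hcx]] Hc]].
  { apply NoDup_grid; apply seq_NoDup. }
  { unfold l. rewrite length_prod, !length_seq. unfold N, n. nia. }
  exists n, (fun i j => c (i, j)). split.
  { exists (fst x), (snd x). rewrite <- surjective_pairing. apply Hl in Hx. tauto. }
  intros [s v] Hcurve HD0.
  assert (H0 : lsum l (fun x => c x * mono x (s, v)) = 0).
  { rewrite (lsum_ext _ _ (fun x => 1 * (c x * peval (fst (ab x)) s)
                                    + v * (c x * peval (snd (ab x)) s))).
    - rewrite lsum_lin, (lsum_peval l c N s (fun x => fst (ab x))),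
        (lsum_peval l c N s (fun x => snd (ab x))); [ring | | | |].
      + intros y Hy. apply (Hab y Hy).
      + intros k Hk. refine (eq_trans _ (Hc (N + k)%nat _)); [|lia]. apply lsum_ext.
        intros y _. destruct (Nat.ltb_spec (N + k) N); [lia|].
        now replace (N + k - N)%nat with k by lia.
      + intros y Hy. apply (Hab y Hy).
      + intros k Hk. refine (eq_trans _ (Hc k _)); [|lia]. apply lsum_ext.
        intros y _. destruct (Nat.ltb_spec k N); [easy | lia].
    - intros y Hy. destruct (Hab y Hy) as [_ [_ E]]. rewrite E by easy. ring. }
  unfold eval2.
  rewrite <- (lsum_grid n (fun i j => c (i, j) * (X (s, v) / D (s, v)) ^ i * (Y (s, v) / D (s, v)) ^ j)).
  fold l.
  rewrite (lsum_ext _ _ (fun x => / D (s, v) ^ (2 * n) * (c x * mono x (s, v)) + 0 * 0)).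
  - rewrite lsum_lin, H0. ring.
  - intros y Hy. apply Hl in Hy. unfold mono. rewrite <- surjective_pairing.
    replace (D (s, v) ^ (2 * n))
      with (D (s, v) ^ fst y * D (s, v) ^ snd y * D (s, v) ^ (2 * n - fst y - snd y))
      by (rewrite <- !Cpow_add_r; f_equal; lia).
    unfold Cdiv. rewrite !Cpow_mult_l, !Cpow_inv by easy.
    field. repeat split; now apply Cpow_nz.
Qed.

(** Polynomials in (s, v), without control of the degree. *)
Definition curve_poly (f : C * C -> C) : Prop := exists k, curve_poly_le k f.

Lemma curve_poly_const (c : C) : curve_poly (fun _ => c).
Proof. exists 1%nat. apply curve_poly_le_const. Qed.

Lemma curve_poly_plus (f g : C * C -> C) :
  curve_poly f -> curve_poly g -> curve_poly (fun p => f p + g p).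
Proof. intros [j Hf] [k Hg]. exists (j + k)%nat. now apply curve_poly_le_plus. Qed.

Lemma curve_poly_mult (f g : C * C -> C) :
  curve_poly f -> curve_poly g -> curve_poly (fun p => f p * g p).
Proof. intros [j Hf] [k Hg]. exists (j + k + 4)%nat. now apply curve_poly_le_mult. Qed.

Lemma curve_poly_minus (f g : C * C -> C) :
  curve_poly f -> curve_poly g -> curve_poly (fun p => f p - g p).
Proof.
  intros Hf Hg.
  destruct (curve_poly_plus f _ Hf (curve_poly_mult _ g (curve_poly_const (-1)) Hg))
    as [k [a [b [Ha [Hb E]]]]].
  exists k, a, b. repeat split; [easy | easy |].
  intros s v H. rewrite <- E by easy. ring.
Qed.

Lemma curve_poly_pow (f : C * C -> C) (n : nat) : curve_poly f -> curve_poly (fun p => f p ^ n).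
Proof. intros [d Hf]. exists ((d + 4) * n + 1)%nat. now apply curve_poly_le_pow. Qed.

Ltac prove_curve_poly :=
  lazymatch goal with
  | |- curve_poly (fun p => fst p) => exists 2%nat; exact curve_poly_le_fst
  | |- curve_poly (fun p => snd p) => exists 1%nat; exact curve_poly_le_snd
  | |- curve_poly (fun p => @?f p + @?g p) => apply (curve_poly_plus f g); prove_curve_poly
  | |- curve_poly (fun p => @?f p - @?g p) => apply (curve_poly_minus f g); prove_curve_poly
  | |- curve_poly (fun p => @?f p * @?g p) => apply (curve_poly_mult f g); prove_curve_poly
  | |- curve_poly (fun p => @?f p ^ ?n) => apply (curve_poly_pow f n); prove_curve_poly
  | |- curve_poly (fun _ => ?a) => exact (curve_poly_const a)
  end.

Lemma curve_poly_algebraic_dependence (X Y D : C * C -> C) :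
  curve_poly X -> curve_poly Y -> curve_poly D ->
  exists n a, nonzero2 n a /\ forall p, curve41 p -> D p <> 0 ->
    eval2 n a (X p / D p) (Y p / D p) = 0.
Proof.
  intros [i HX] [j HY] [k HD].
  apply (algebraic_dependence (i + j + k)).
  - apply (curve_poly_le_mono i); [lia | assumption].
  - apply (curve_poly_le_mono j); [lia | assumption].
  - apply (curve_poly_le_mono k); [lia | assumption].
Qed.

(** * The rational functions of s *)

Definition quad (s : C) : C := 8 * s ^ 2 - 11 * s + 8.
Definition octic (s : C) : C :=
  32 * s ^ 8 - 320 * s ^ 7 + 1112 * s ^ 6 - 2420 * s ^ 5
  + 3167 * s ^ 4 - 2420 * s ^ 3 + 1112 * s ^ 2 - 320 * s + 32.
Definition cubic (s : C) : C := 2 * s ^ 3 + 4 * s ^ 2 - 4 * s + 3.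
Definition y_num (s : C) : C :=
  56 * s ^ 7 - 166 * s ^ 6 + 318 * s ^ 5 - 269 * s ^ 4 + 31 * s ^ 3
  + 75 * s ^ 2 - 28 * s + 8.
Definition slope_num (s : C) : C :=
  28 * s ^ 7 + 174 * s ^ 6 - 752 * s ^ 5 + 1155 * s ^ 4 - 810 * s ^ 3
  + 322 * s ^ 2 - 64 * s + 72.

(** The square of T - 1/2. *)
Definition sqT (s : C) : C :=
  ((s + 1) * octic s) ^ 2 / (2916 * s ^ 5 * (s - 1) ^ 2 * quad s ^ 3).
(** The derivative of [sqT]. *)
Definition dsqT (s : C) : C :=
  5 * (s + 1) * octic s * (2 * s ^ 2 + s + 2) ^ 2 * (2 * s - 1) ^ 4 * (s - 2) ^ 4
  / (729 * s ^ 6 * (s - 1) ^ 3 * quad s ^ 4).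
(** The quotient (y - 1/2) / (T - 1/2). *)
Definition ratio (s : C) : C :=
  -3 * s * quad s * y_num s / ((s + 1) * octic s * cubic s).
(** The derivative dy/dT, which is invariant under v |-> - v. *)
Definition slope (s : C) : C :=
  -3 * s * quad s * slope_num s
  / (10 * cubic s ^ 2 * (2 * s ^ 2 + s + 2) * (2 * s - 1) * (s - 2) ^ 3).

(** The factors of T, T - 1, y, y - 1, y - T, of dT/ds and of the denominators:
    away from the zeros of this product everything is regular. *)
Definition bad_poly (s : C) : C :=
  s * (s - 1) * (s + 1) * quad s * cubic s * octic s * (2 * s ^ 2 + s + 2)
  * (2 * s - 1) * (s - 2) * (s ^ 2 - 2 * s + 6)
  * (49 * s ^ 4 - 86 * s ^ 3 + 54 * s ^ 2 + 4 * s + 4) * (s ^ 2 - 7 * s + 1).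

Ltac split_good H :=
  let split_one Q :=
    (let Hq := fresh "Hne" in
     assert (Hq : Q <> 0) by (intros Hq; apply H; unfold bad_poly; rewrite Hq; ring)) in
  match type of H with context [bad_poly ?s] =>
    split_one s; split_one (s - 1); split_one (s + 1); split_one (quad s);
    split_one (cubic s); split_one (octic s); split_one (2 * s ^ 2 + s + 2);
    split_one (2 * s - 1); split_one (s - 2); split_one (s ^ 2 - 2 * s + 6);
    split_one (49 * s ^ 4 - 86 * s ^ 3 + 54 * s ^ 2 + 4 * s + 4);
    split_one (s ^ 2 - 7 * s + 1)
  end.

Ltac split_side := repeat match goal with |- _ /\ _ => split end; try assumption.

(** This is T (T - 1). *)
Lemma sqT_minus_quarter (s : C) : bad_poly s <> 0 ->
  sqT s - 1 / 4 =
  (s ^ 2 - 7 * s + 1) * (2 * s ^ 2 + s + 2) ^ 3 * ((2 * s - 1) * (s - 2)) ^ 5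
  / (729 * s ^ 5 * (s - 1) ^ 2 * quad s ^ 3).
Proof.
  intros H. split_good H. unfold sqT.
  field_simplify_eq; [unfold octic, quad; ring | split_side].
Qed.

(** This is (y - T) / (T - 1/2). *)
Lemma ratio_minus_1 (s : C) : bad_poly s <> 0 ->
  ratio s - 1 =
  - (s ^ 2 - 2 * s + 6) * (2 * s ^ 2 + s + 2) ^ 2 * (s - 2) ^ 2 * (2 * s - 1) ^ 4
  / ((s + 1) * octic s * cubic s).
Proof.
  intros H. split_good H. unfold ratio.
  field_simplify_eq; [unfold octic, quad, cubic, y_num; ring | split_side].
Qed.

(** This is y (y - 1). *)
Lemma sqy_minus_quarter (s : C) : bad_poly s <> 0 ->
  sqT s * ratio s ^ 2 - 1 / 4 =
  (49 * s ^ 4 - 86 * s ^ 3 + 54 * s ^ 2 + 4 * s + 4) * (2 * s ^ 2 + s + 2) ^ 2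
  * (s - 2) ^ 2 * (2 * s - 1) ^ 4
  / (324 * s ^ 3 * (s - 1) ^ 2 * quad s * cubic s ^ 2).
Proof.
  intros H. split_good H. unfold ratio, sqT.
  field_simplify_eq; [unfold quad, cubic, y_num; ring | split_side].
Qed.

(** The terms with beta = -1/18 and gamma = 1/18 combine to -1/18 times
    (T (y - 1)^2 - (T - 1) y^2) / (y (y - 1))^2, whose numerator is this
    function. *)
Lemma beta_gamma_numerator (s : C) : bad_poly s <> 0 ->
  sqT s * ratio s ^ 2 - 2 * sqT s * ratio s + 1 / 4 =
  (28 * s ^ 4 - 27 * s ^ 3 - 42 * s ^ 2 + 28 * s - 12) * (2 * s ^ 2 + s + 2) ^ 3
  * (s - 2) ^ 4 * (2 * s - 1) ^ 5
  / (972 * s ^ 4 * (s - 1) ^ 2 * quad s ^ 2 * cubic s ^ 2).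
Proof.
  intros H. split_good H. unfold ratio, sqT.
  field_simplify_eq; [unfold quad, cubic, y_num, octic; ring | split_side].
Qed.

Lemma sqT_regular (s : C) : bad_poly s <> 0 ->
  sqT s <> 0 /\ dsqT s <> 0 /\ sqT s - 1 / 4 <> 0 /\ ratio s - 1 <> 0 /\
  sqT s * ratio s ^ 2 - 1 / 4 <> 0.
Proof.
  intros H. assert (H' := H). split_good H.
  rewrite sqT_minus_quarter, ratio_minus_1, sqy_minus_quarter by assumption.
  unfold sqT, dsqT. repeat split; nonzero.
Qed.

(** The right-hand side of the equation divided by u = t - 1/2, for
    theta = (1/3, 1/3, 1/3, 1/3), in terms of g = u^2, r = (y - 1/2) / u and
    m = dy/dt; it depends on u only through g because the equation is odd under
    (t, y) |-> (1 - t, 1 - y). *)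
Definition reduced_PVI_rhs (g r m : C) : C :=
  (r / (g * r ^ 2 - 1 / 4) + 1 / (2 * g * (r - 1))) * m ^ 2
  - (2 / (g - 1 / 4) + 1 / (g * (r - 1))) * m
  + (g * r ^ 2 - 1 / 4) * (r - 1) / (g - 1 / 4) ^ 2
    * (2 / 9
       - (g * r ^ 2 - 2 * g * r + 1 / 4) / (18 * (g * r ^ 2 - 1 / 4) ^ 2)
       + 4 / 9 * (g - 1 / 4) / (g * (r - 1) ^ 2)).

Lemma is_derive_sqT (s : C) : bad_poly s <> 0 -> is_derive sqT s (dsqT s).
Proof.
  intros H. split_good H. eapply is_derive_C_eq.
  - unfold sqT, octic, quad. derive_C. nonzero.
  - unfold dsqT, octic, quad. numerals. field. split_side.
Qed.

(** This says that [slope] is the derivative of y with respect to T: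
    d(u r)/du = r + u r' ds/du, where 2 u du = g' ds. *)
Lemma is_derive_ratio (s : C) : bad_poly s <> 0 ->
  is_derive ratio s ((slope s - ratio s) * dsqT s / (2 * sqT s)).
Proof.
  intros H. split_good H. eapply is_derive_C_eq.
  - unfold ratio, octic, quad, cubic, y_num. derive_C. nonzero.
  - unfold dsqT, sqT, slope, ratio, slope_num, y_num, cubic. numerals.
    field_simplify_eq; [unfold octic, quad; ring | unfold octic, quad; split_side].
Qed.

(** The sixth Painleve equation itself, after d^2y/dT^2 = m' ds/du = 2 u m' / g'
    and division by u. *)
Lemma is_derive_slope (s : C) : bad_poly s <> 0 ->
  is_derive slope s (dsqT s / 2 * reduced_PVI_rhs (sqT s) (ratio s) (slope s)).
Proof.
  intros H. assert (H' := H). split_good H. eapply is_derive_C_eq.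
  - unfold slope, quad, slope_num, cubic. derive_C. nonzero.
  - unfold reduced_PVI_rhs.
    rewrite sqT_minus_quarter, ratio_minus_1, sqy_minus_quarter, beta_gamma_numerator
      by assumption.
    unfold sqT, ratio, slope, slope_num, y_num, dsqT, cubic. numerals.
    field_simplify_eq; [unfold octic, quad; ring | unfold octic, quad; split_side].
Qed.

(** * The equation in centred coordinates *)

Lemma PVI_rhs_centred (u r m : C) :
  u <> 0 -> u ^ 2 - 1 / 4 <> 0 -> u ^ 2 * r ^ 2 - 1 / 4 <> 0 -> r - 1 <> 0 ->
  PVI_regular (1 / 2 + u) (1 / 2 + u * r) /\
  PVI_rhs (1 / 3) (1 / 3) (1 / 3) (1 / 3) (1 / 2 + u) (1 / 2 + u * r) m
  = u * reduced_PVI_rhs (u ^ 2) r m.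
Proof.
  intros Hu Ht Hy Hr.
  assert (Hsq : forall x : C, x ^ 2 - 1 / 4 <> 0 -> 1 / 2 + x <> 0 /\ 1 / 2 + x <> 1).
  { intros x Hx. split; intros E; apply Hx.
    - replace x with (1 / 2 + x - 1 / 2) by ring. rewrite E. field.
    - replace x with (1 / 2 + x - 1 / 2) by ring. rewrite E. field. }
  destruct (Hsq u Ht) as [Ht0 Ht1].
  destruct (Hsq (u * r)) as [Hy0 Hy1].
  { replace ((u * r) ^ 2) with (u ^ 2 * r ^ 2) by ring. exact Hy. }
  assert (Hyt : u * (r - 1) <> 0) by now apply Cmult_neq_0.
  split.
  - repeat split; try assumption.
    intros E. apply Hyt.
    replace (u * (r - 1)) with (1 / 2 + u * r - (1 / 2 + u)) by ring. rewrite E. ring.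
  - apply Cminus_eq_contra in Ht1, Hy1.
    unfold PVI_rhs, reduced_PVI_rhs. field.
    repeat split; cbv beta; try assumption.
    + replace ((u * r) ^ 2 * 4 - 1) with (4 * (u ^ 2 * r ^ 2 - 1 / 4)) by field. nonzero.
    + replace (u ^ 2 * 4 - 1) with (4 * (u ^ 2 - 1 / 4)) by field. nonzero.
    + replace (1 + u * r * 2 - (1 + u * 2)) with (2 * (u * (r - 1))) by ring. nonzero.
    + replace (1 + u * r * 2 - 2) with (2 * (1 / 2 + u * r - 1)) by field. nonzero.
    + replace (1 + u * r * 2) with (2 * (1 / 2 + u * r)) by field. nonzero.
    + replace (1 + u * 2 - 2) with (2 * (1 / 2 + u - 1)) by field. nonzero.
    + replace (1 + u * 2) with (2 * (1 / 2 + u)) by field. nonzero.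
Qed.

(** * Neighbourhoods and exceptional points *)

Lemma is_derive_locally (f : C -> C) (x l : C) (P : C -> Prop) :
  is_derive f x l -> locally (f x) P -> locally x (fun z => P (f z)).
Proof.
  intros Hf HP. apply locally_C.
  apply (ex_derive_continuous (K := C_AbsRing) (V := C_NormedModule) f x); [|easy].
  now exists l.
Qed.

Lemma ex_derive_bad_poly (s : C) : exists l : C, is_derive bad_poly s l.
Proof. eexists. unfold bad_poly, quad, cubic, octic. derive_C. Qed.

Lemma locally_bad_poly_neq_0 (s : C) :
  bad_poly s <> 0 -> locally s (fun z => bad_poly z <> 0).
Proof.
  intros H. destruct (ex_derive_bad_poly s) as [l Hl].
  apply (is_derive_locally bad_poly s l (fun w => w <> 0) Hl).
  apply locally_C_Cmod. exists (Cmod (bad_poly s)). split; [now apply Cmod_gt_0|].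
  intros y Hy E. rewrite E in Hy.
  replace (0 - bad_poly s) with (- bad_poly s) in Hy by ring.
  rewrite Cmod_opp in Hy. lra.
Qed.

Lemma continuous_dsqT (s : C) : bad_poly s <> 0 -> continuous dsqT s.
Proof.
  intros H. split_good H. intros P HP.
  assert (Hd : exists l : C, is_derive dsqT s l).
  { eexists. unfold dsqT, octic, quad. derive_C. nonzero. }
  destruct Hd as [l Hl]. exact (is_derive_locally dsqT s l P Hl HP).
Qed.

Lemma finite_zeros_bad_poly : finite_zeros bad_poly.
Proof.
  unfold bad_poly.
  repeat (apply finite_zeros_mult).
  - apply (finite_zeros_ext (peval ([RtoC 0] ++ [RtoC 1]))); [intros s; simpl; ring|].
    apply peval_finite_zeros. nonzero.
  - apply (finite_zeros_ext (peval ([RtoC (-1)] ++ [RtoC 1]))); [intros s; simpl; ring|].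
    apply peval_finite_zeros. nonzero.
  - apply (finite_zeros_ext (peval ([RtoC 1] ++ [RtoC 1]))); [intros s; simpl; ring|].
    apply peval_finite_zeros. nonzero.
  - apply (finite_zeros_ext (peval ([RtoC 8; RtoC (-11)] ++ [RtoC 8])));
      [intros s; unfold quad; simpl; ring|].
    apply peval_finite_zeros. nonzero.
  - apply (finite_zeros_ext (peval ([RtoC 3; RtoC (-4); RtoC 4] ++ [RtoC 2])));
      [intros s; unfold cubic; simpl; ring|].
    apply peval_finite_zeros. nonzero.
  - apply (finite_zeros_ext (peval ([RtoC 32; RtoC (-320); RtoC 1112; RtoC (-2420);
      RtoC 3167; RtoC (-2420); RtoC 1112; RtoC (-320)] ++ [RtoC 32])));
      [intros s; unfold octic; simpl; ring|].
    apply peval_finite_zeros. nonzero.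
  - apply (finite_zeros_ext (peval ([RtoC 2; RtoC 1] ++ [RtoC 2]))); [intros s; simpl; ring|].
    apply peval_finite_zeros. nonzero.
  - apply (finite_zeros_ext (peval ([RtoC (-1)] ++ [RtoC 2]))); [intros s; simpl; ring|].
    apply peval_finite_zeros. nonzero.
  - apply (finite_zeros_ext (peval ([RtoC (-2)] ++ [RtoC 1]))); [intros s; simpl; ring|].
    apply peval_finite_zeros. nonzero.
  - apply (finite_zeros_ext (peval ([RtoC 6; RtoC (-2)] ++ [RtoC 1])));
      [intros s; simpl; ring|].
    apply peval_finite_zeros. nonzero.
  - apply (finite_zeros_ext (peval ([RtoC 4; RtoC 4; RtoC 54; RtoC (-86)] ++ [RtoC 49])));
      [intros s; simpl; ring|].
    apply peval_finite_zeros. nonzero.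
  - apply (finite_zeros_ext (peval ([RtoC 1; RtoC (-7)] ++ [RtoC 1])));
      [intros s; simpl; ring|].
    apply peval_finite_zeros. nonzero.
Qed.

(** Above each of the finitely many zeros of [bad_poly] the curve has finitely
    many points. *)
Lemma for_almost_all_curve41 (P : C * C -> Prop) :
  (forall s v, curve41 (s, v) -> bad_poly s <> 0 -> P (s, v)) ->
  for_almost_all curve41 P.
Proof.
  intros HP. destruct finite_zeros_bad_poly as [L HL].
  assert (HE : exists E, forall s v, In s L -> curve41 (s, v) -> In (s, v) E).
  { clear HL. induction L as [|s0 L [E HE]]; [now exists []|].
    assert (Hv : finite_zeros (fun v => v ^ 2 - s0 * quad s0)).
    { apply (finite_zeros_ext (peval ([- (s0 * quad s0); RtoC 0] ++ [RtoC 1])));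
        [intros v; simpl; ring|].
      apply peval_finite_zeros. nonzero. }
    destruct Hv as [V HV]. exists (map (pair s0) V ++ E).
    intros s v [<-|Hs] Hc; apply in_or_app; [left | right; now apply HE].
    apply in_map, HV. unfold curve41 in Hc. unfold quad. rewrite Hc. ring. }
  destruct HE as [E HE]. exists E. intros [s v] Hc Hn.
  apply HP; [easy|]. intros Hs. apply Hn, HE; [now apply HL | easy].
Qed.

(** * The parametrization *)

Lemma curve41_v_neq_0 (s v : C) : curve41 (s, v) -> bad_poly s <> 0 -> v <> 0.
Proof.
  intros Hc H Hv. split_good H. unfold curve41 in Hc. rewrite Hv in Hc.
  apply (Cmult_neq_0 s (quad s)); try assumption. unfold quad. rewrite <- Hc. ring.
Qed.

Lemma T41_y41_centred (s v : C) : curve41 (s, v) -> bad_poly s <> 0 ->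
  T41 (s, v) = 1 / 2 + (s + 1) * octic s / (54 * s * (s - 1) * (s * quad s * v)) /\
  (T41 (s, v) - 1 / 2) ^ 2 = sqT s /\
  y41 (s, v) = 1 / 2 + (T41 (s, v) - 1 / 2) * ratio s.
Proof.
  intros Hc H. assert (Hv := curve41_v_neq_0 s v Hc H). split_good H.
  assert (E2 : v ^ 2 = s * quad s) by exact Hc.
  assert (E : T41 (s, v)
              = 1 / 2 + (s + 1) * octic s / (54 * s * (s - 1) * (s * quad s * v))).
  { rewrite <- E2. unfold T41. fold (octic s). field. split_side. }
  split; [exact E|]. rewrite E. split.
  - replace ((1 / 2 + (s + 1) * octic s / (54 * s * (s - 1) * (s * quad s * v)) - 1 / 2) ^ 2)
      with (((s + 1) * octic s) ^ 2 / (2916 * s ^ 4 * (s - 1) ^ 2 * quad s ^ 2 * v ^ 2))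
      by (field; split_side).
    rewrite E2. unfold sqT. field. split_side.
  - unfold y41. fold (y_num s). fold (cubic s). unfold ratio. field. split_side.
Qed.

Lemma infinitely_many_integers (L : list C) : exists n : nat, ~ In (RtoC (INR n)) L.
Proof.
  assert (HM : exists M : R, forall z, In z L -> (Cmod z <= M)%R).
  { induction L as [|z L [M HM]]; [exists 0%R; easy|].
    exists (Rmax (Cmod z) M). intros w [<-|Hw]; [apply Rmax_l|].
    eapply Rle_trans; [now apply HM | apply Rmax_r]. }
  destruct HM as [M HM]. destruct (INR_unbounded M) as [n Hn].
  exists n. intros Hin. specialize (HM _ Hin).
  rewrite Cmod_R, Rabs_pos_eq in HM by apply pos_INR. lra.
Qed.

(** T - 1/2 is odd in v, so that T takes different values at (s, v) and (s, - v).
    Integers s = n give such pairs of points outside any finite set, with v real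
    because 8 n^2 - 11 n + 8 > 0. *)
Lemma T41_nonconstant : nonconstant_on curve41 T41.
Proof.
  intros c [E HE]. destruct finite_zeros_bad_poly as [L HL].
  destruct (infinitely_many_integers (L ++ map fst E)) as [n Hn].
  set (s := RtoC (INR n)) in *.
  assert (Hs : bad_poly s <> 0) by (intros H; apply Hn, in_or_app; left; now apply HL).
  assert (HsE : forall v, ~ In (s, v) E).
  { intros v H. apply Hn, in_or_app. right. exact (in_map fst _ _ H). }
  set (v := RtoC (sqrt (INR n * (8 * INR n ^ 2 - 11 * INR n + 8)))).
  assert (Hv : curve41 (s, v)).
  { unfold curve41, v, s. rewrite <- RtoC_pow, pow2_sqrt.
    - now rewrite !RtoC_mult, RtoC_plus, RtoC_minus, !RtoC_mult, RtoC_pow.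
    - apply Rmult_le_pos; [apply pos_INR | nra]. }
  assert (Hv' : curve41 (s, - v)).
  { unfold curve41 in *. rewrite <- Hv. ring. }
  assert (T1 := HE _ Hv (HsE v)). assert (T2 := HE _ Hv' (HsE (- v))).
  assert (Hv0 := curve41_v_neq_0 s v Hv Hs).
  rewrite (proj1 (T41_y41_centred s v Hv Hs)) in T1.
  rewrite (proj1 (T41_y41_centred s (- v) Hv' Hs)) in T2.
  rewrite <- T2 in T1. split_good Hs.
  assert (D : (s + 1) * octic s / (27 * s * (s - 1) * (s * quad s * v)) <> 0) by nonzero.
  apply D.
  replace ((s + 1) * octic s / (27 * s * (s - 1) * (s * quad s * v)))
    with (1 / 2 + (s + 1) * octic s / (54 * s * (s - 1) * (s * quad s * v))
          - (1 / 2 + (s + 1) * octic s / (54 * s * (s - 1) * (s * quad s * - v))))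
    by (field; split_side).
  rewrite T1. ring.
Qed.

(** The common denominator 108 s (s - 1) cubic(s) v^4 of T and y is a polynomial
    in (s, v). *)
Lemma T41_y41_algebraic : exists n a, nonzero2 n a /\
  forall s v, curve41 (s, v) -> bad_poly s <> 0 -> eval2 n a (T41 (s, v)) (y41 (s, v)) = 0.
Proof.
  destruct (curve_poly_algebraic_dependence
    (fun p => 54 * fst p * (fst p - 1) * cubic (fst p) * snd p ^ 4
              + 2 * (fst p + 1) * octic (fst p) * cubic (fst p) * snd p)
    (fun p => 54 * fst p * (fst p - 1) * cubic (fst p) * snd p ^ 4
              - 6 * y_num (fst p) * snd p ^ 3)
    (fun p => 108 * fst p * (fst p - 1) * cubic (fst p) * snd p ^ 4))
    as [n [a [Ha H]]].
  1-3: unfold cubic, octic, y_num; prove_curve_poly.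
  exists n, a. split; [exact Ha|]. intros s v Hc Hs.
  assert (Hv := curve41_v_neq_0 s v Hc Hs). split_good Hs.
  specialize (H (s, v) Hc). cbn [fst snd] in H.
  rewrite <- H by nonzero. f_equal.
  - unfold T41. fold (octic s). field. split_side.
  - unfold y41. fold (y_num s) (cubic s). field. split_side.
Qed.

(** The last clause lifts t back to the curve: s = sigma(u^2) determines v by
    the formula for T, since v^3 = v s quad(s) makes this formula linear in 1/v;
    then v^2 = s quad(s) is the equation u^2 = g(s). *)
Lemma solution_near_point (s0 v0 : C) :
  curve41 (s0, v0) -> bad_poly s0 <> 0 ->
  exists Y : C -> C,
    locally (s0, v0) (fun q : C * C => curve41 q -> y41 q = Y (T41 q)) /\
    solves_PVI_near (1 / 3) (1 / 3) (1 / 3) (1 / 3) Y (T41 (s0, v0)) /\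
    locally (T41 (s0, v0)) (fun t => exists s v,
      curve41 (s, v) /\ bad_poly s <> 0 /\ T41 (s, v) = t /\ y41 (s, v) = Y t).
Proof.
  intros Hc Hs.
  assert (Hgood := locally_bad_poly_neq_0 s0 Hs).
  destruct (sqT_regular s0 Hs) as [_ [Hd _]].
  destruct (holomorphic_local_inverse sqT dsqT s0) as [sigma [Hleft Hright]].
  { apply (filter_imp (fun z => bad_poly z <> 0)); [|exact Hgood].
    exact is_derive_sqT. }
  { now apply continuous_dsqT. }
  { exact Hd. }
  assert (Hsigma0 : sigma (sqT s0) = s0) by exact (locally_singleton _ _ Hleft).
  destruct (locally_singleton _ _ Hright) as [_ Hdsigma0].
  assert (Hright' : locally (sqT s0) (fun w =>
    (sqT (sigma w) = w /\ is_derive sigma w (/ dsqT (sigma w))) /\ bad_poly (sigma w) <> 0)).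
  { apply filter_and; [exact Hright|].
    apply (is_derive_locally sigma _ _ (fun z => bad_poly z <> 0) Hdsigma0).
    now rewrite Hsigma0. }
  assert (Hsq : forall t : C, is_derive (fun t => (t - 1 / 2) ^ 2) t (2 * (t - 1 / 2))).
  { intros t. eapply is_derive_C_eq; [derive_C; nonzero|]. numerals. field. }
  assert (Hnear : locally (T41 (s0, v0)) (fun t =>
    let w := (t - 1 / 2) ^ 2 in
    (sqT (sigma w) = w /\ is_derive sigma w (/ dsqT (sigma w))) /\ bad_poly (sigma w) <> 0)).
  { destruct (T41_y41_centred s0 v0 Hc Hs) as [_ [E _]].
    rewrite <- E in Hright'.
    exact (is_derive_locally _ _ _ _ (Hsq (T41 (s0, v0))) Hright'). }
  exists (fun t => 1 / 2 + (t - 1 / 2) * ratio (sigma ((t - 1 / 2) ^ 2))).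
  split; [|split].
  - assert (H := filter_and _ _ Hleft Hgood). destruct H as [eps Heps].
    assert (Hq : forall s v : C, ball s0 eps s -> curve41 (s, v) -> y41 (s, v) =
      1 / 2 + (T41 (s, v) - 1 / 2) * ratio (sigma ((T41 (s, v) - 1 / 2) ^ 2))).
    { intros s v Hball Hcq. destruct (Heps s Hball) as [Hsig Hsg].
      destruct (T41_y41_centred s v Hcq Hsg) as [_ [E1 E2]].
      now rewrite E1, Hsig. }
    exists eps. intros [s v] [Hball _]. exact (Hq s v Hball).
  - exists (fun t => slope (sigma ((t - 1 / 2) ^ 2))).
    exists (fun t => (t - 1 / 2) * reduced_PVI_rhs ((t - 1 / 2) ^ 2)
              (ratio (sigma ((t - 1 / 2) ^ 2))) (slope (sigma ((t - 1 / 2) ^ 2)))).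
    refine (filter_imp _ _ _ Hnear).
    intros t [[Hw Hds] Hsg].
    change C in t. set (s := sigma ((t - 1 / 2) ^ 2)) in *.
    destruct (sqT_regular s Hsg) as [Hg [Hdg [Ht [Hr Hy]]]].
    assert (Hu : t - 1 / 2 <> 0).
    { intros E. apply Hg. rewrite Hw, E. ring. }
    assert (Hdst : is_derive (fun t => sigma ((t - 1 / 2) ^ 2)) t
                     (2 * (t - 1 / 2) * / dsqT s))
      by exact (is_derive_C_comp sigma (fun t => (t - 1 / 2) ^ 2) t _ _ Hds (Hsq t)).
    destruct (PVI_rhs_centred (t - 1 / 2) (ratio s) (slope s)) as [Hreg Hrhs];
      try (rewrite <- Hw; assumption); try assumption.
    assert (Et : 1 / 2 + (t - 1 / 2) = t :> C) by ring. rewrite Et in Hreg, Hrhs.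
    split; [|split; [|split]].
    + eapply is_derive_C_eq.
      * apply is_derive_C_plus; [apply is_derive_C_const|].
        apply is_derive_C_mult; [derive_C; nonzero|].
        apply (is_derive_C_comp ratio (fun t => sigma ((t - 1 / 2) ^ 2)) t _ _ (is_derive_ratio s Hsg) Hdst).
      * cbv beta. fold s. clearbody s. rewrite Hw. generalize (t - 1 / 2) Hu.
        intros u Hu'. field. split_side.
    + eapply is_derive_C_eq.
      * apply (is_derive_C_comp slope (fun t => sigma ((t - 1 / 2) ^ 2)) t _ _ (is_derive_slope s Hsg) Hdst).
      * rewrite Hw. field. exact Hdg.
    + exact Hreg.
    + rewrite Hrhs. reflexivity.
  - refine (filter_imp _ _ _ Hnear).
    intros t [[Hw _] Hsg]. cbv beta.
    change C in t. set (s := sigma ((t - 1 / 2) ^ 2)) in *.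
    assert (Et : 1 / 2 + (t - 1 / 2) = t :> C) by ring.
    clearbody s. revert Et Hw. generalize (t - 1 / 2). intros u <- Hw.
    destruct (sqT_regular s Hsg) as [Hg _].
    assert (Hu : u <> 0).
    { intros E. apply Hg. rewrite Hw, E. ring. }
    set (v := (s + 1) * octic s / (54 * s * (s - 1) * (s * quad s * u))).
    assert (Hsg' := Hsg). split_good Hsg'.
    assert (Hcv : curve41 (s, v)).
    { change (v ^ 2 = s * quad s). unfold v.
      replace (((s + 1) * octic s / (54 * s * (s - 1) * (s * quad s * u))) ^ 2)
        with (((s + 1) * octic s) ^ 2 / (2916 * s ^ 4 * (s - 1) ^ 2 * quad s ^ 2 * u ^ 2))
        by (field; split_side).
      rewrite <- Hw. unfold sqT. field. split_side. }
    destruct (T41_y41_centred s v Hcv Hsg) as [E1 [_ E2]].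
    assert (ET : T41 (s, v) = 1 / 2 + u).
    { rewrite E1. unfold v. field. split_side. }
    exists s, v. rewrite E2, ET.
    split; [exact Hcv | split; [exact Hsg | split; [reflexivity | ring]]].
Qed.

Theorem mainTheorem8 :
  parametrize_algebraic_PVI_solution curve41 T41 y41
    (1 / 3) (1 / 3) (1 / 3) (1 / 3).
Proof.
  split; [exact T41_nonconstant|].
  destruct T41_y41_algebraic as [n [a [Ha Hrel]]].
  exists n, a. split; [exact Ha|].
  apply for_almost_all_curve41. intros s v Hc Hs.
  destruct (solution_near_point s v Hc Hs) as [Y [Hq [Hsol Hpar]]].
  exists Y. split; [exact Hq|]. split; [exact Hsol|].
  revert Hpar. apply filter_imp.
  intros t [s' [v' [Hc' [Hs' [<- <-]]]]]. now apply Hrel.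
Qed.
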